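(* Let $S=\langle s_1,\dots,s_{n-k}\rangle$ be the stabilizer group of an $[[n,k]]$ stabilizer code with logical $Z$ operators $\bar Z_1,\dots,\bar Z_k$, and let $g_0,\dots,g_{n-1}$ be an enumeration of the $n$ operators $\{s_1,\dots,s_{n-k}\}\cup\{\bar Z_1,\dots,\bar Z_k\}$. Suppose the following protocol (distributed stabilizer code encoding) is executed on $n$ master (syndrome) qubits $q_0,\dots,q_{n-1}$ and $n$ data qubits $Q_0,\dots,Q_{n-1}$: 1. Prepare $q_0,\dots,q_{n-1}$ in the state $|+\rangle^{\otimes n}$ and $Q_0,\dots,Q_{n-1}$ in the state $|0\rangle^{\otimes n}$. 2. For each $i=0,\dots,n-1$, writing $g_i=\bigotimes_{j} P_j$ with $P_j\in\{I,X,Y,Z\}$, apply for each $j$ with $P_j\neq I$ the controlled-$P_j$ gate with control $q_i$ and target $Q_j$. 3. Measure every $q_i$ in the $X$-basis, obtaining $m=(m_0,\dots,m_{n-1})\in\{0,1\}^n$, where $m_i=0$ denotes the result $|+\rangle$ and $m_i=1$ the result $|-\rangle$. 4. Apply to the data qubits the Pauli correction operator $P_{corr}=P_{corr}(m)$. Then, for every outcome $m$ that occurs with nonzero probability, the final state of the data qubits is the logical zero state $|0\dots0\rangle_L$; that is, it is a simultaneous $+1$ eigenvector of all $s_i$ and of all $\bar Z_j$.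
   Context: An $[[n,k]]$ stabilizer code is given by an abelian subgroup $S$ of the $n$-qubit Pauli group with $-I\notin S$, generated by $n-k$ independent commuting Pauli operators $s_1,\dots,s_{n-k}$; the codespace is the joint $+1$ eigenspace of $S$. The logical $Z$ operators $\bar Z_1,\dots,\bar Z_k$ are $n$-qubit Hermitian Pauli operators that commute with each other and with all of $S$ and such that the $n$ operators $s_1,\dots,s_{n-k},\bar Z_1,\dots,\bar Z_k$ are independent and generate a group not containing $-I$. Each operator is written as a tensor product of single-qubit Paulis. The logical zero state $|0\dots0\rangle_L$ is the (unique up to phase) unit vector that is a $+1$ eigenvector of all $s_i$ and all $\bar Z_j$. For each $m\in\{0,1\}^n$, the correction operator $P_{corr}(m)$ is a fixed (pre-computed) $n$-qubit Pauli operator that anticommutes with $g_i$ whenever $m_i=1$ and commutes with $g_i$ whenever $m_i=0$; such an operator exists for every $m$. The data qubit $Q_j$ is held by a remote node $L_j$ and the qubits $q_i$ by a master node. The non-local controlled-Pauli gates are realized by a gate-teleportation protocol that consumes one Bell pair per gate and whose net effect is exactly the controlled-Pauli gate. *)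

(* Defs.v *)
From HB Require Import structures.
From mathcomp Require Import all_boot all_order all_algebra all_fingroup.

Set Implicit Arguments.
Unset Strict Implicit.
Unset Printing Implicit Defensive.

Import GRing.Theory Num.Theory.
Local Open Scope ring_scope.

(** * The Pauli group *)

Inductive letter := PI | PX | PY | PZ.

Definition letter_code (p : letter) : bool * bool :=
  match p with
  | PI => (false, false) | PX => (true, false)
  | PY => (true, true)   | PZ => (false, true)
  end.

Definition letter_decode (c : bool * bool) : letter :=
  match c with
  | (false, false) => PI | (true, false) => PX
  | (true, true) => PY   | (false, true) => PZ
  end.

Lemma letter_codeK : cancel letter_code letter_decode.
Proof. by case. Qed.

HB.instance Definition _ := Finite.copy letter (can_type letter_codeK).

(* The product of two letters p, q is i^(letter_phase p q) times the letter
   letter_mul p q; for instance XY = iZ and YX = -iZ. *)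
Definition letter_mul (p q : letter) : letter :=
  match p, q with
  | PI, r | r, PI => r
  | PX, PX | PY, PY | PZ, PZ => PI
  | PX, PY | PY, PX => PZ
  | PY, PZ | PZ, PY => PX
  | PX, PZ | PZ, PX => PY
  end.

Definition letter_phase (p q : letter) : 'Z_4 :=
  match p, q with
  | PX, PY | PY, PZ | PZ, PX => 1
  | PY, PX | PZ, PY | PX, PZ => - 1
  | _, _ => 0
  end.

(* The Pauli operator i^a (P_0 (x) ... (x) P_{n-1}), stored as its phase
   exponent a and its letters P_j. *)
Record pauli (n : nat) : Type :=
  Pauli { phase : 'Z_4; letters : {ffun 'I_n -> letter} }.

Definition pauli_code n (p : pauli n) := (phase p, letters p).
Definition pauli_decode n (c : 'Z_4 * {ffun 'I_n -> letter}) := Pauli c.1 c.2.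

Lemma pauli_codeK n : cancel (@pauli_code n) (@pauli_decode n).
Proof. by case. Qed.

HB.instance Definition _ n := Finite.copy (pauli n) (can_type (@pauli_codeK n)).

Definition pauli_one n : pauli n := Pauli 0 [ffun=> PI].

Definition pauli_mul n (p q : pauli n) : pauli n :=
  Pauli (phase p + phase q + \sum_j letter_phase (letters p j) (letters q j))
        [ffun j => letter_mul (letters p j) (letters q j)].

Definition pauli_inv n (p : pauli n) : pauli n := Pauli (- phase p) (letters p).

Lemma pauli_mulA n : associative (@pauli_mul n).
Proof.
move=> p q r; congr Pauli; last first.
  by apply/ffunP => j; rewrite !ffunE; do 3!case: (letters _ j).
transitivity (phase p + phase q + phase r +
    \sum_j (letter_phase (letters q j) (letters r j) +
            letter_phase (letters p j) (letter_mul (letters q j) (letters r j)))).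
  rewrite big_split /= -!addrA; do 4!congr (_ + _).
  by apply: eq_bigr => j _; rewrite ffunE.
transitivity (phase p + phase q + phase r +
    \sum_j (letter_phase (letters p j) (letters q j) +
            letter_phase (letter_mul (letters p j) (letters q j)) (letters r j))).
  by congr (_ + _); apply: eq_bigr => j _; do 3!case: (letters _ j); apply/eqP.
rewrite big_split /= addrA; congr (_ + _); first by rewrite addrAC.
by apply: eq_bigr => j _; rewrite ffunE.
Qed.

Lemma pauli_mul1 n : left_id (pauli_one n) (@pauli_mul n).
Proof.
case=> a f; congr Pauli => /=; last by apply/ffunP => j; rewrite !ffunE.
by rewrite add0r big1 ?addr0 // => j _; rewrite ffunE.
Qed.

Lemma pauli_mulV n : left_inverse (pauli_one n) (@pauli_inv n) (@pauli_mul n).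
Proof.
case=> a f; congr Pauli => /=.
  by rewrite addNr add0r big1 // => j _; case: (f j).
by apply/ffunP => j; rewrite !ffunE; case: (f j).
Qed.

HB.instance Definition _ n :=
  Finite_isGroup.Build (pauli n) (@pauli_mulA n) (@pauli_mul1 n) (@pauli_mulV n).

(* The operator - I. *)
Definition negI n : pauli n := Pauli 2%:R [ffun=> PI].

Definition tensor_pauli n (P : 'I_n -> letter) : pauli n :=
  Pauli 0 (finfun P).

Definition anticommute n (p q : pauli n) : Prop :=
  (p * q = negI n * (q * p))%g.

(** * States and operators *)

(* Vectors over the computational basis T; for n qubits T is bits n, for two
   registers it is a product of such types. *)
Definition bits (n : nat) := {ffun 'I_n -> 'I_2}.
Definition state (C : numClosedFieldType) (T : finType) := {ffun T -> C}.

(* An operator is given by its matrix entries <x|A|y>. *)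
Definition op (C : numClosedFieldType) (T : finType) := T -> T -> C.

Definition opid (C : numClosedFieldType) (T : finType) : op C T :=
  fun x y => (x == y)%:R.

Definition opadd (C : numClosedFieldType) (T : finType) (A B : op C T) : op C T :=
  fun x y => A x y + B x y.

Definition kron (C : numClosedFieldType) (T U : finType) (A : op C T) (B : op C U) :
    op C (T * U)%type :=
  fun x y => A x.1 y.1 * B x.2 y.2.

(* A_0 (x) ... (x) A_{n-1} for single-qubit operators A_j. *)
Definition tensor_op (C : numClosedFieldType) n (A : 'I_n -> 'M[C]_2) :
    op C (bits n) :=
  fun x y => \prod_j A j (x j) (y j).

Definition opon (C : numClosedFieldType) n (j : 'I_n) (U : 'M[C]_2) :
    op C (bits n) :=
  tensor_op (fun j' => if j' == j then U else 1%:M).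

Definition apply (C : numClosedFieldType) (T : finType) (A : op C T)
    (psi : state C T) : state C T :=
  [ffun x => \sum_y A x y * psi y].

Definition state_norm (C : numClosedFieldType) (T : finType) (psi : state C T) : C :=
  sqrtC (\sum_x `|psi x| ^+ 2).

Definition normalize (C : numClosedFieldType) (T : finType) (psi : state C T) :
    state C T :=
  [ffun x => psi x / state_norm psi].

Definition tensor_state (C : numClosedFieldType) (T U : finType)
    (psi : state C T) (phi : state C U) : state C (T * U)%type :=
  [ffun x => psi x.1 * phi x.2].

Definition product_state (C : numClosedFieldType) n (v : 'I_n -> 'cV[C]_2) :
    state C (bits n) :=
  [ffun x : bits n => \prod_i v i (x i) 0].

Definition ketZ (C : numClosedFieldType) (b : 'I_2) : 'cV[C]_2 := delta_mx b 0.

(* |+> for b = 0 and |-> for b = 1. *)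
Definition ketX (C : numClosedFieldType) (b : 'I_2) : 'cV[C]_2 :=
  \col_(a < 2) ((-1) ^+ (b * a)%N / sqrtC 2%:R).

Definition proj (C : numClosedFieldType) (v : 'cV[C]_2) : 'M[C]_2 :=
  v *m map_mx Num.conj v^T.

(** * Pauli operators as operators *)

Definition mx2 (C : numClosedFieldType) (a b c d : C) : 'M[C]_2 :=
  \matrix_(i < 2, j < 2)
    (if i == 0 then if j == 0 then a else b else if j == 0 then c else d).

Definition sigma (C : numClosedFieldType) (p : letter) : 'M[C]_2 :=
  match p with
  | PI => mx2 1 0 0 1
  | PX => mx2 0 1 1 0
  | PY => mx2 0 (- 'i) 'i 0
  | PZ => mx2 1 0 0 (- 1)
  end.

Definition pauli_op (C : numClosedFieldType) n (p : pauli n) : op C (bits n) :=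
  fun x y => 'i ^+ phase p * tensor_op (fun j => sigma C (letters p j)) x y.

Definition pauli_hermitian (C : numClosedFieldType) n (p : pauli n) : Prop :=
  forall x y, pauli_op C p x y = (pauli_op C p y x)^*.

Lemma expi_mod4 (C : numClosedFieldType) (a : nat) :
  'i ^+ (a %% 4) = 'i ^+ a :> C.
Proof.
rewrite [in RHS](divn_eq a 4) exprD mulnC exprM.
have -> : 'i ^+ 4 = 1 :> C by rewrite (exprM _ 2 2) sqrCi sqrrN expr1n.
by rewrite expr1n mul1r.
Qed.

Lemma expiD (C : numClosedFieldType) (a b : 'Z_4) :
  'i ^+ (a + b)%R = 'i ^+ a * 'i ^+ b :> C.
Proof. by rewrite -exprD -[in RHS]expi_mod4. Qed.

Lemma sigmaM (C : numClosedFieldType) (p q : letter) :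
  sigma C p *m sigma C q = 'i ^+ letter_phase p q *: sigma C (letter_mul p q).
Proof.
have i2 : 'i * 'i = -1 :> C by rewrite -expr2 sqrCi.
have i3 : 'i ^+ 3 = - 'i :> C by rewrite exprS sqrCi mulrN1.
apply/matrixP => i j; rewrite !mxE big_ord_recl big_ord1.
by case: p; case: q; rewrite !mxE; case: i => [[|[|//]] hi];
  case: j => [[|[|//]] hj];
  rewrite /= ?expr0 ?expr1 ?i3 ?(mul0r, mulr0, mul1r, mulr1, add0r, addr0,
    mulrN, mulNr, i2, opprK, oppr0).
Qed.

(* By pauli_opM and pauli_op_inj, (anti)commutation, independence and the
   condition on - I in the group pauli n are those of the operators. *)
Lemma pauli_opM (C : numClosedFieldType) n (p q : pauli n) (x y : bits n) :
  \sum_z pauli_op C p x z * pauli_op C q z y = pauli_op C (p * q)%g x y.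
Proof.
rewrite /pauli_op /tensor_op.
rewrite (_ : phase (p * q)%g = phase p + phase q +
  \sum_j letter_phase (letters p j) (letters q j)) // 2!expiD.
have -> : 'i ^+ (\sum_j letter_phase (letters p j) (letters q j))%R =
    \prod_j 'i ^+ letter_phase (letters p j) (letters q j) :> C.
  by apply: (big_morph (fun a : 'Z_4 => 'i ^+ a : C)) => // a b; rewrite expiD.
under [LHS]eq_bigr do rewrite mulrACA -big_split /=.
rewrite -mulr_sumr -[RHS]mulrA -big_split /=; congr (_ * _).
rewrite -(bigA_distr_bigA (fun j b =>
  sigma C (letters p j) (x j) b * sigma C (letters q j) b (y j))).
apply: eq_bigr => j _; rewrite ffunE.
by move/matrixP/(_ (x j) (y j)): (sigmaM C (letters p j) (letters q j)); rewrite !mxE.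
Qed.

Lemma pauli_op1 (C : numClosedFieldType) n (x y : bits n) :
  pauli_op C (1 : pauli n)%g x y = (x == y)%:R.
Proof.
rewrite /pauli_op /tensor_op /= expr0 mul1r.
under eq_bigr => j _.
  have -> : sigma C ([ffun=> PI] j) (x j) (y j) = (x j == y j)%:R.
    rewrite ffunE mxE; case: (x j) => [[|[|//]] ?]; by case: (y j) => [[|[|//]] ?].
  over.
have [->|] := eqVneq x y; first by rewrite big1 // => j _; rewrite eqxx.
move=> neq_xy; have [j /negPf xyj] : exists j, x j != y j.
  apply/existsP; apply: contraR neq_xy; rewrite negb_exists => /forallP h.
  by apply/eqP/ffunP => j; apply/eqP; rewrite -[_ == _]negbK.
by rewrite (bigD1 j) //= xyj mul0r.
Qed.

Lemma pauli_op_inj (C : numClosedFieldType) n (p q : pauli n) :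
  (forall x y, pauli_op C p x y = pauli_op C q x y) -> p = q.
Proof.
move=> eq_pq; apply/eqP; rewrite eq_mulgV1; apply/eqP.
have: forall x y, pauli_op C (p * q^-1)%g x y = (x == y)%:R.
  move=> x y; rewrite -pauli_op1 -(mulgV q) -!pauli_opM.
  by apply: eq_bigr => z _; rewrite eq_pq.
move: (p * q^-1)%g => {p q eq_pq} [a f] opE.
have dg (x : bits n) : 'i ^+ a * \prod_j sigma C (f j) (x j) (x j) = 1 :> C.
  by have := opE x x; rewrite eqxx.
have fIZ j : (f j == PI) || (f j == PZ).
  have := dg [ffun=> 0]; rewrite (bigD1 j) //= ffunE mulrCA.
  case: (f j) => //; rewrite mxE /= mul0r => /esym/eqP;
  by rewrite oner_eq0.
have ia : 'i ^+ a = 1 :> C.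
  rewrite -(dg [ffun=> 0]) big1 ?mulr1 // => j _.
  by move: (fIZ j); rewrite ffunE; case: (f j) => //; rewrite mxE.
have a0 : a = 0.
  case: a ia {opE dg} => [[|[|[|[|//]]]] ha] ia; apply: val_inj => //=; exfalso.
  - by have := sqrCi C; rewrite -[X in X ^+ 2]expr1 ia expr1n => /eqP;
      rewrite eq_sym eqNr oner_eq0.
  - by move/eqP: ia; rewrite /= sqrCi eqNr oner_eq0.
  - move: ia; rewrite /= exprS sqrCi mulrN1 => /(congr1 (fun z => z ^+ 2)).
    by rewrite sqrrN sqrCi expr1n => /eqP; rewrite eqNr oner_eq0.
rewrite a0; congr Pauli; apply/ffunP => j; rewrite ffunE.
have := dg [ffun j' => if j' == j then 1 else 0]; rewrite ia mul1r (bigD1 j) //=.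
rewrite big1 ?mulr1 => [|j' /negPf jj']; last first.
  by move: (fIZ j'); rewrite ffunE jj'; case: (f j') => //; rewrite mxE.
move: (fIZ j); rewrite ffunE eqxx; case: (f j) => //; rewrite mxE /= => _ /eqP.
by rewrite eqNr oner_eq0.
Qed.

(** * Stabilizer codes *)

(* No member of the family lies in the group generated by the others. *)
Definition independent (gT : finGroupType) (I : finType) (h : I -> gT) : Prop :=
  forall i, h i \notin <<[set h j | j in [set~ i]]>>%g.

Definition stabilizer_code n k (S : {group pauli n}) (s : 'I_(n - k) -> pauli n) :
    Prop :=
  [/\ (k <= n)%N, abelian S, negI n \notin S,
      (S : {set pauli n}) = <<[set s i | i : 'I_(n - k)]>>%g & independent s].

Definition join_family (I J : finType) (T : Type) (s : I -> T) (z : J -> T)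
    (u : I + J) : T :=
  match u with inl i => s i | inr j => z j end.

Definition logical_Z (C : numClosedFieldType) n k (S : {group pauli n})
    (s : 'I_(n - k) -> pauli n) (Zbar : 'I_k -> pauli n) : Prop :=
  [/\ forall j, pauli_hermitian C (Zbar j),
      forall j j', commute (Zbar j) (Zbar j'),
      forall j x, x \in S -> commute (Zbar j) x,
      independent (join_family s Zbar) &
      negI n \notin <<[set join_family s Zbar u | u : 'I_(n - k) + 'I_k]>>%g].

Definition enumerates n k (g : 'I_n -> pauli n) (s : 'I_(n - k) -> pauli n)
    (Zbar : 'I_k -> pauli n) : Prop :=
  injective g /\
  [set g i | i : 'I_n] =
    [set s i | i : 'I_(n - k)] :|: [set Zbar j | j : 'I_k].

Definition logical_zero (C : numClosedFieldType) n k (s : 'I_(n - k) -> pauli n)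
    (Zbar : 'I_k -> pauli n) (phi : state C (bits n)) : Prop :=
  [/\ state_norm phi = 1,
      forall i, apply (pauli_op C (s i)) phi = phi &
      forall j, apply (pauli_op C (Zbar j)) phi = phi].

(** * The encoding protocol *)

(* The first register holds the master qubits q_i, the second one the data
   qubits Q_j. *)
Definition joint_state (C : numClosedFieldType) n :=
  state C (bits n * bits n)%type.

Definition initial_state (C : numClosedFieldType) n : joint_state C n :=
  tensor_state (product_state (fun _ : 'I_n => ketX C 0))
               (product_state (fun _ : 'I_n => ketZ C 0)).

(* |0><0| (x) I + |1><1| (x) P, with control q_i and target Q_j. *)
Definition controlled (C : numClosedFieldType) n (p : letter) (i j : 'I_n) :
    op C (bits n * bits n)%type :=
  opadd (kron (opon i (proj (ketZ C 0))) (@opid C (bits n)))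
        (kron (opon i (proj (ketZ C 1))) (opon j (sigma C p))).

(* P i j is the letter of g_i at the data qubit Q_j. *)
Definition controlled_row (C : numClosedFieldType) n (P : 'I_n -> 'I_n -> letter)
    (i : 'I_n) (psi : joint_state C n) : joint_state C n :=
  foldl (fun chi j => apply (controlled C (P i j) i j) chi) psi
        [seq j <- enum 'I_n | P i j != PI].

Definition entangled_state (C : numClosedFieldType) n
    (P : 'I_n -> 'I_n -> letter) : joint_state C n :=
  foldl (fun chi i => controlled_row P i chi) (initial_state C n) (enum 'I_n).

(* The projection of psi for the outcome m of the X-basis measurement of all
   the master qubits. *)
Definition measureX (C : numClosedFieldType) n (m : bits n)
    (psi : joint_state C n) : joint_state C n :=
  apply (kron (tensor_op (fun i => proj (ketX C (m i)))) (@opid C (bits n))) psi.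

Definition outcome_prob (C : numClosedFieldType) n
    (P : 'I_n -> 'I_n -> letter) (m : bits n) : C :=
  state_norm (measureX m (entangled_state C P)) ^+ 2.

Definition final_state (C : numClosedFieldType) n (P : 'I_n -> 'I_n -> letter)
    (Pcorr : bits n -> pauli n) (m : bits n) : joint_state C n :=
  apply (kron (@opid C (bits n)) (pauli_op C (Pcorr m)))
        (normalize (measureX m (entangled_state C P))).

Definition correction_for n (g : 'I_n -> pauli n) (Pcorr : bits n -> pauli n) :
    Prop :=
  forall (m : bits n) (i : 'I_n),
    if m i == 1 then anticommute (Pcorr m) (g i) else commute (Pcorr m) (g i).

(* The data qubits of the joint state psi are in the pure state phi, the master
   qubits being left in the measured state |+/->_m. *)
Definition data_state (C : numClosedFieldType) n (m : bits n)
    (psi : joint_state C n) (phi : state C (bits n)) : Prop :=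
  psi = tensor_state (product_state (fun i => ketX C (m i))) phi.

(* Main.v *)
Require Import Defs.
From mathcomp Require Import all_boot all_order all_algebra all_fingroup.

Set Implicit Arguments.
Unset Strict Implicit.
Unset Printing Implicit Defensive.

Import GRing.Theory Num.Theory.

(** The controlled gates turn the branch [|a>] of the master register into
    [|a> (x) g^a |0>], where [g^a] is the product of the [g_i] with [a_i = 1].
    Since the [g_i] commute and square to the identity, [g_i] maps the data
    state of the branch [a] to that of the branch with the bit [a_i] flipped.
    Outcome [m] projects onto [w = sum_a (-1)^(m.a) g^a |0>] up to a scalar,
    and reindexing the sum by the flip gives [g_i w = (-1)^(m_i) w]. The
    correction operator absorbs the sign, and it is unitary. *)

(** * Operators and Pauli elements acting on states *)

Lemma apply_comp (C : numClosedFieldType) (T : finType) (A B D : op C T)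
    (psi : state C T) :
  (forall x y, (\sum_z A x z * B z y)%R = D x y) ->
  apply A (apply B psi) = apply D psi.
Proof.
move=> AB; apply/ffunP=> x; rewrite !ffunE.
under eq_bigr do rewrite ffunE mulr_sumr.
rewrite exchange_big; apply: eq_bigr => y _ /=.
by rewrite -AB mulr_suml; apply: eq_bigr => z _; rewrite mulrA.
Qed.

Lemma apply_ext (C : numClosedFieldType) (T : finType) (A B : op C T)
    (psi : state C T) : A =2 B -> apply A psi = apply B psi.
Proof.
by move=> AB; apply/ffunP=> x; rewrite !ffunE; apply: eq_bigr => y _; rewrite AB.
Qed.

Lemma apply_scale (C : numClosedFieldType) (T : finType) (A : op C T) (c : C)
    (psi : state C T) :
  apply A [ffun x => c * psi x]%R = [ffun x => c * apply A psi x]%R.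
Proof.
apply/ffunP=> x; rewrite !ffunE mulr_sumr.
by apply: eq_bigr => y _; rewrite ffunE mulrCA.
Qed.

Lemma sum_opid (C : numClosedFieldType) (T : finType) (F : T -> C) x :
  (\sum_y opid C x y * F y)%R = F x.
Proof.
rewrite (bigD1 x) //= /opid eqxx mul1r big1 ?addr0 // => y /negPf yx.
by rewrite eq_sym yx mul0r.
Qed.

Lemma apply_pauliM (C : numClosedFieldType) n (p q : pauli n) psi :
  apply (pauli_op C p) (apply (pauli_op C q) psi) =
  apply (pauli_op C (p * q)%g) psi.
Proof. by apply: apply_comp => x y; rewrite pauli_opM. Qed.

Lemma apply_pauli1 (C : numClosedFieldType) n psi :
  apply (pauli_op C (1 : pauli n)%g) psi = psi.
Proof.
apply/ffunP=> x; rewrite ffunE -[RHS](sum_opid psi).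
by apply: eq_bigr => y _; rewrite pauli_op1.
Qed.

Lemma apply_negI (C : numClosedFieldType) n psi :
  apply (pauli_op C (negI n)) psi = [ffun x => - psi x]%R.
Proof.
apply/ffunP=> x; rewrite !ffunE -[psi x in RHS](sum_opid psi) -sumrN.
apply: eq_bigr => y _; rewrite /opid -pauli_op1 /pauli_op /=.
by rewrite expr0 mul1r sqrCi !mulN1r mulNr.
Qed.

(** The phase exponent 0 matters: a prefactor [i^a] would make the square [(-1)^a]. *)
Lemma tensor_pauli_sqr n (P : 'I_n -> letter) :
  (tensor_pauli P * tensor_pauli P)%g = 1%g.
Proof.
congr Pauli => /=.
  by rewrite !add0r big1 // => j _; rewrite ffunE; case: (P j).
by apply/ffunP=> j; rewrite !ffunE; case: (P j).
Qed.

(** * Unitarity and norms *)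

Lemma pauli_op_adj (C : numClosedFieldType) n (p : pauli n) x y :
  ((pauli_op C p y x)^*)%R = pauli_op C p^-1%g x y.
Proof.
rewrite /pauli_op /tensor_op rmorphM rmorph_prod rmorphXn /=.
congr (_ * _)%R.
  (* Both sides are inverses of ['i ^+ phase p]: the conjugate because ['i] has modulus 1, the other
     because exponents add in ['Z_4]. *)
  have iU : ('i ^+ phase p != 0 :> C)%R by rewrite expf_neq0 ?neq0Ci.
  have iN : ('i ^+ phase p * 'i ^+ (- phase p)%R = 1 :> C)%R.
    by rewrite -expiD subrr expr0.
  by apply: (mulfI iU); rewrite -rmorphXn -normCK normrX normCi !expr1n.
apply: eq_bigr => j _; case: (letters p j); rewrite !mxE;
  case: (x j) => [[|[|//]] ?]; case: (y j) => [[|[|//]] ?] //=;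
  by rewrite ?rmorph0 ?rmorph1 ?rmorphN ?rmorph1 //= conjCi ?opprK.
Qed.

(** With [v = p psi] and [psi = p^-1 v], the squared norms of [v] and [psi] expand to the same
    double sum, since [p^-1] is the adjoint of [p]. *)
Lemma state_norm_pauli (C : numClosedFieldType) n (p : pauli n) psi :
  state_norm (apply (pauli_op C p) psi) = state_norm psi.
Proof.
have sqE (T : finType) (u : state C T) :
    (\sum_x `|u x| ^+ 2 = \sum_x u x * (u x)^* :> C)%R.
  by apply: eq_bigr => x _; rewrite normCK.
rewrite /state_norm !sqE; congr sqrtC.
set v := apply _ psi.
have psiE : psi = apply (pauli_op C p^-1%g) v.
  by rewrite apply_pauliM mulVg apply_pauli1.
transitivity (\sum_x \sum_y v x * ((pauli_op C p x y)^* * (psi y)^*))%R.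
  apply: eq_bigr => x _; rewrite -mulr_sumr {2}/v ffunE rmorph_sum.
  by congr (_ * _)%R; apply: eq_bigr => y _; rewrite rmorphM.
rewrite exchange_big; apply: eq_bigr => y _ /=.
rewrite {2}psiE ffunE mulr_suml; apply: eq_bigr => x _.
by rewrite pauli_op_adj mulrA [(v x * _)%R]mulrC.
Qed.

Lemma state_norm_normalize (C : numClosedFieldType) (T : finType)
    (psi : state C T) : state_norm psi <> 0%R -> state_norm (normalize psi) = 1%R.
Proof.
move=> /eqP N0; rewrite {1}/state_norm.
have S0 : (0 <= \sum_x `|psi x| ^+ 2 :> C)%R.
  by apply: sumr_ge0 => x _; rewrite exprn_ge0.
under eq_bigr do rewrite ffunE normf_div expr_div_n.
have -> : (`|state_norm psi| = state_norm psi)%R.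
  by apply: ger0_norm; rewrite sqrtC_ge0.
rewrite -mulr_suml -[X in (X / _)%R]sqrtCK divff ?sqrtC1 //.
by rewrite expf_neq0.
Qed.

Lemma state_norm_tensor (C : numClosedFieldType) (T U : finType)
    (psi : state C T) (phi : state C U) :
  state_norm (tensor_state psi phi) = (state_norm psi * state_norm phi)%R.
Proof.
have ge0 (V : finType) (u : state C V) : (0 <= \sum_x `|u x| ^+ 2 :> C)%R.
  by apply: sumr_ge0 => x _; rewrite exprn_ge0.
rewrite /state_norm -sqrtCM ?qualifE /= ?ge0 //; congr sqrtC.
rewrite mulr_suml; under [RHS]eq_bigr do rewrite mulr_sumr.
rewrite (pair_big xpredT xpredT) /=.
by apply: eq_bigr => x _; rewrite ffunE normrM exprMn.
Qed.

Lemma state_norm_product_ketX (C : numClosedFieldType) n (m : bits n) :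
  state_norm (product_state (fun i => ketX C (m i))) = 1%R.
Proof.
rewrite /state_norm -[RHS]sqrtC1; congr sqrtC.
under eq_bigr do rewrite ffunE normr_prod -prodrXl.
(* The sum over bit strings factors into one sum per qubit, each with two terms equal to 1/2. *)
rewrite -(bigA_distr_bigA (fun i (b : 'I_2) => `|ketX C (m i) b 0| ^+ 2)%R).
apply: big1 => i _; under eq_bigr do rewrite mxE normf_div normrX normrN1
  expr1n div1r exprVn ger0_norm ?sqrtC_ge0 ?ler0n // sqrtCK.
by rewrite sumr_const card_ord -[LHS]mulr_natr mulVf ?pnatr_eq0.
Qed.

(** * Controlled gates, branch by branch *)

(** The unnormalized data state in the branch [a] of the master register. All controls are diagonal
    in this basis, so the gates act on each branch separately. *)
Definition slice (C : numClosedFieldType) (T U : finType)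
  (psi : state C (T * U)%type) (a : T) : state C U := [ffun x => psi (a, x)].

Lemma slice_kron (C : numClosedFieldType) (T U : finType) (A : op C T)
    (B : op C U) (psi : state C (T * U)%type) a x :
  slice (apply (kron A B) psi) a x =
  (\sum_b A a b * apply B (slice psi b) x)%R.
Proof.
rewrite !ffunE; under [RHS]eq_bigr do rewrite ffunE mulr_sumr.
rewrite (pair_big xpredT xpredT) /=.
by apply: eq_bigr => -[b y] _; rewrite ffunE mulrA.
Qed.

Lemma apply_opid (C : numClosedFieldType) (T : finType) (psi : state C T) :
  apply (@opid C T) psi = psi.
Proof. by apply/ffunP=> x; rewrite ffunE sum_opid. Qed.

Definition single_pauli n (j : 'I_n) (p : letter) : pauli n :=
  tensor_pauli (fun j' => if j' == j then p else PI).

Lemma opon_single_pauli (C : numClosedFieldType) n (j : 'I_n) p x y :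
  opon j (sigma C p) x y = pauli_op C (single_pauli j p) x y.
Proof.
rewrite /pauli_op /= expr0 mul1r; apply: eq_bigr => j' _; rewrite ffunE.
case: eqP => // _; rewrite !mxE.
by case: (x j') => [[|[|//]] ?]; case: (y j') => [[|[|//]] ?].
Qed.

Lemma opon_proj_ketZ (C : numClosedFieldType) n (i : 'I_n) b x y :
  opon i (proj (ketZ C b)) x y = ((x i == b)%:R * opid C x y)%R.
Proof.
have projE (c d : 'I_2) : (proj (ketZ C b) c d = ((c == b) && (d == b))%:R)%R.
  by rewrite !mxE big_ord1 !mxE !eqxx !andbT rmorph_nat -natrM mulnb.
rewrite /opid; have [<-|neq_xy] := eqVneq x y.
  rewrite mulr1 /opon /tensor_op (bigD1 i) //= eqxx projE andbb big1 ?mulr1 //.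
  by move=> j /negPf ->; rewrite mxE eqxx.
have [j xyj] : exists j, x j != y j.
  apply/existsP; apply: contraR neq_xy; rewrite negb_exists => /forallP h.
  by apply/eqP/ffunP => j; apply/eqP; rewrite -[_ == _]negbK.
rewrite mulr0 /opon /tensor_op (bigD1 j) //=; case: eqP => _.
  by rewrite projE; case: eqP => [e|]; case: eqP => [f|];
    rewrite ?mul0r //; case/eqP: xyj; rewrite e f.
by rewrite mxE (negPf xyj) mul0r.
Qed.

(** The two summands of the gate carry complementary indicators of the bit [a i], so exactly one
    survives. *)
Lemma slice_controlled (C : numClosedFieldType) n p (i j : 'I_n)
    (psi : joint_state C n) a :
  slice (apply (controlled C p i j) psi) a =
  if a i == 0%R then slice psi a
  else apply (pauli_op C (single_pauli j p)) (slice psi a).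
Proof.
have addE (A B : op C (bits n * bits n)%type) :
    apply (opadd A B) psi = [ffun x => apply A psi x + apply B psi x]%R.
  apply/ffunP=> x; rewrite !ffunE -big_split; apply: eq_bigr => y _.
  by rewrite /opadd mulrDl.
apply/ffunP=> x; rewrite ffunE /controlled addE ffunE.
have sliceE (phi : joint_state C n) : phi (a, x) = slice phi a x by rewrite ffunE.
rewrite !sliceE !slice_kron.
under eq_bigr do rewrite opon_proj_ketZ apply_opid -mulrA.
rewrite -mulr_sumr sum_opid.
under eq_bigr do rewrite opon_proj_ketZ (apply_ext _ (opon_single_pauli C j p)) -mulrA.
rewrite -mulr_sumr (sum_opid (fun b => apply _ (slice psi b) x)).
by case: (a i) => [[|[|//]] ?] /=; rewrite mul0r mul1r ?add0r ?addr0.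
Qed.

(** As [r] has no repetition, two letters other than [PI] never meet at a qubit, and the product
    acquires no phase. Induction runs from the right end because the last gate applied is the left
    factor. *)
Lemma foldl_single_pauli (C : numClosedFieldType) n (P : 'I_n -> letter)
    (r : seq 'I_n) psi : uniq r ->
  foldl (fun chi j => apply (pauli_op C (single_pauli j (P j))) chi) psi r =
  apply (pauli_op C (tensor_pauli (fun j => if j \in r then P j else PI))) psi.
Proof.
elim/last_ind: r => [|r j IHr] /=.
  by move=> _; rewrite -[LHS]apply_pauli1; congr (apply (pauli_op C _) psi).
rewrite rcons_uniq foldl_rcons => /andP[/negPf jr /IHr ->].
rewrite apply_pauliM; congr (apply (pauli_op C _) psi); congr Pauli => /=.
  rewrite !add0r big1 // => j' _; rewrite !ffunE.
  by case: eqP => [->|_]; rewrite ?jr //; case: (P j).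
apply/ffunP=> j'; rewrite !ffunE mem_rcons inE.
by case: eqP => [->|_] //; rewrite jr; case: (P j).
Qed.

(** The positions filtered out carry [PI], so the gates kept already multiply to the full tensor
    product. *)
Lemma slice_controlled_row (C : numClosedFieldType) n
    (P : 'I_n -> 'I_n -> letter) i (psi : joint_state C n) a :
  slice (controlled_row P i psi) a =
  if a i == 0%R then slice psi a
  else apply (pauli_op C (tensor_pauli (P i))) (slice psi a).
Proof.
have -> : tensor_pauli (P i) = tensor_pauli (fun j =>
    if j \in [seq j <- enum 'I_n | P i j != PI] then P i j else PI).
  congr Pauli; apply/ffunP=> j; rewrite !ffunE mem_filter mem_enum andbT.
  by case: eqP.
rewrite -foldl_single_pauli ?(filter_uniq _ (enum_uniq _)) // /controlled_row.
elim: [seq _ <- _ | _] psi => [|j r IHr] psi /=; first by case: ifP.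
by rewrite IHr slice_controlled; case: (a i == _).
Qed.

(** * Flipping one master bit *)

(** On ['I_2], [rev_ord] exchanges 0 and 1. *)
Definition flip n (i : 'I_n) (a : bits n) : bits n :=
  [ffun j => if j == i then rev_ord (a j) else a j].

Lemma flipK n (i : 'I_n) : involutive (flip i).
Proof. by move=> a; apply/ffunP=> j; rewrite !ffunE; case: eqP; rewrite ?rev_ordK. Qed.

Definition pauli_branch (C : numClosedFieldType) n (g : 'I_n -> pauli n)
    (a : bits n) (v : state C (bits n)) (i : 'I_n) : state C (bits n) :=
  if a i == 0%R then v else apply (pauli_op C (g i)) v.

(** The flip inserts or removes one factor [g i]. Commutation brings that factor to the front, and
    [g i] squaring to 1 accounts for a removal. *)
Lemma foldl_pauli_branch_flip (C : numClosedFieldType) n (g : 'I_n -> pauli n)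
    a (v : state C (bits n)) i r :
    (forall j, commute (g i) (g j)) -> (g i * g i)%g = 1%g ->
    uniq r -> i \in r ->
  foldl (pauli_branch g (flip i a)) v r =
  apply (pauli_op C (g i)) (foldl (pauli_branch g a) v r).
Proof.
move=> cgi gi2; elim/last_ind: r => // r j IHr.
rewrite rcons_uniq mem_rcons inE !foldl_rcons => /andP[jr ur].
case: (eqVneq i j) => [eij _ | neij /= ir].
  rewrite -{j}eij in jr *.
  (* Here [i] is the last index, absent from [r], so the earlier steps do not see the flip. *)
  have -> : foldl (pauli_branch g (flip i a)) v r = foldl (pauli_branch g a) v r.
    clear IHr ur; elim: r v jr => //= j r IHr v; rewrite inE negb_or => /andP[ij ir].
    by rewrite IHr // /pauli_branch ffunE [j == i]eq_sym (negPf ij).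
  rewrite /pauli_branch ffunE eqxx.
  case: (a i) => [[|[|//]] ?] //=.
  by rewrite apply_pauliM gi2 apply_pauli1.
(* The last step [j] differs from [i]: it is the same on both sides, and [g i] moves past [g j]. *)
rewrite IHr // /pauli_branch ffunE [j == i]eq_sym (negPf neij).
by case: eqP => // _; rewrite !apply_pauliM cgi.
Qed.

Lemma slice_entangled_state (C : numClosedFieldType) n
    (P : 'I_n -> 'I_n -> letter) a :
  slice (entangled_state C P) a =
  foldl (pauli_branch (fun i => tensor_pauli (P i)) a)
    (slice (initial_state C n) a) (enum 'I_n).
Proof.
rewrite /entangled_state; elim: (enum _) (initial_state _ _) => //= i r IHr psi.
by rewrite IHr slice_controlled_row.
Qed.

(** All amplitudes of the master state |+...+> are equal. *)
Lemma slice_initial_state (C : numClosedFieldType) n (a b : bits n) :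
  slice (initial_state C n) a = slice (initial_state C n) b.
Proof.
apply/ffunP=> x; rewrite !ffunE /=; congr (_ * _)%R.
by apply: eq_bigr => i _; rewrite !mxE !mul0n.
Qed.

(** * Measurement in the X-basis *)

(** The partial inner product with the X-basis state of outcome [m]: the unnormalized data state
    after the measurement. *)
Definition data_part (C : numClosedFieldType) n (m : bits n)
    (psi : joint_state C n) : state C (bits n) :=
  [ffun x => \sum_(b : bits n) (\prod_i ketX C (m i) (b i) 0)^* * psi (b, x)]%R.

(** The projector onto the outcome has rank one, so the measurement disentangles the registers. *)
Lemma measureX_tensor (C : numClosedFieldType) n (m : bits n)
    (psi : joint_state C n) :
  measureX m psi =
  tensor_state (product_state (fun i => ketX C (m i))) (data_part m psi).
Proof.
apply/ffunP=> -[a x].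
transitivity (slice (measureX m psi) a x); first by rewrite [RHS]ffunE.
rewrite slice_kron !ffunE /= mulr_sumr; apply: eq_bigr => b _.
rewrite apply_opid ffunE mulrA; congr (_ * _)%R.
rewrite rmorph_prod -big_split; apply: eq_bigr => i _ /=.
by rewrite !mxE big_ord1 !mxE.
Qed.

(** Only factor [i] changes, and [m_i (1 - b_i)] has the parity of [m_i + m_i b_i]. *)
Lemma prod_ketX_flip (C : numClosedFieldType) n (m b : bits n) i :
  (\prod_j ketX C (m j) (flip i b j) 0 =
   (-1) ^+ m i * \prod_j ketX C (m j) (b j) 0)%R.
Proof.
rewrite (bigD1 i) //= [in RHS](bigD1 i) //= mulrA; congr (_ * _)%R.
  rewrite ffunE eqxx !mxE.
  by case: (m i) => [[|[|//]] ?]; case: (b i) => [[|[|//]] ?];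
    rewrite /= ?mul0n ?muln0 ?muln1 ?expr0 ?expr1 ?mul1r ?mulrA ?mulrNN ?mul1r.
by apply: eq_bigr => j /negPf ji; rewrite ffunE ji.
Qed.

Lemma data_part_entangled_eigen (C : numClosedFieldType) n
    (P : 'I_n -> 'I_n -> letter) (m : bits n) i :
    (forall j, commute (tensor_pauli (P i)) (tensor_pauli (P j))) ->
  apply (pauli_op C (tensor_pauli (P i))) (data_part m (entangled_state C P)) =
  [ffun x => (-1) ^+ m i * data_part m (entangled_state C P) x]%R.
Proof.
move=> cgi; set g := tensor_pauli (P i); set E := entangled_state C P.
have EF b : apply (pauli_op C g) (slice E b) = slice E (flip i b).
  rewrite !slice_entangled_state (slice_initial_state _ (flip i b) b).
  by rewrite foldl_pauli_branch_flip ?tensor_pauli_sqr ?enum_uniq ?mem_enum.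
apply/ffunP=> x; rewrite !ffunE.
transitivity (\sum_(b : bits n) (\prod_j ketX C (m j) (b j) 0)^* *
    apply (pauli_op C g) (slice E b) x)%R.
  under eq_bigr do rewrite ffunE mulr_sumr.
  rewrite exchange_big; apply: eq_bigr => b _ /=; rewrite ffunE mulr_sumr.
  by apply: eq_bigr => y _; rewrite ffunE mulrCA.
(* After reindexing, the two flips cancel in the slice, while the amplitude releases the sign, which
   is real and so fixed by conjugation. *)
rewrite (reindex_inj (inv_inj (flipK i))) mulr_sumr /=; apply: eq_bigr => b _.
by rewrite EF flipK ffunE prod_ketX_flip rmorphM rmorphXn rmorphN1 mulrA.
Qed.

(** * Correction and final state *)

(** Moving [q] past [p] costs the same sign as the eigenvalue of [q] on [psi], and the two signs
    multiply to 1. *)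
Lemma correction_cancels_sign (C : numClosedFieldType) n (p q : pauli n)
    (b : 'I_2) (psi : state C (bits n)) :
    (if b == 1%R then anticommute p q else commute p q) ->
    apply (pauli_op C q) psi = [ffun x => (-1) ^+ b * psi x]%R ->
  apply (pauli_op C q) (apply (pauli_op C p) psi) = apply (pauli_op C p) psi.
Proof.
case: b => [[|[|//]] ?] /= pq qpsi.
  rewrite apply_pauliM -pq -apply_pauliM qpsi; congr apply.
  by apply/ffunP=> x; rewrite ffunE expr0 mul1r.
(* Evaluated at [psi], anticommutation reads [- p psi = - q (p psi)]. *)
have := congr1 (fun r => apply (pauli_op C r) psi) pq.
rewrite -!apply_pauliM apply_negI qpsi apply_scale => /ffunP h.
by apply/ffunP=> x; move: (h x); rewrite !ffunE expr1 mulN1r => /oppr_inj.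
Qed.

Lemma apply_kron_tensor (C : numClosedFieldType) (T U : finType) (B : op C U)
    (psi : state C T) (phi : state C U) :
  apply (kron (@opid C T) B) (tensor_state psi phi) =
  tensor_state psi (apply B phi).
Proof.
apply/ffunP=> -[a x].
transitivity (slice (apply (kron (@opid C T) B) (tensor_state psi phi)) a x).
  by rewrite [RHS]ffunE.
rewrite slice_kron (sum_opid (fun b => apply B (slice _ b) x)) !ffunE mulr_sumr.
by apply: eq_bigr => y _; rewrite !ffunE mulrCA.
Qed.

Lemma normalize_tensor (C : numClosedFieldType) (T U : finType)
    (psi : state C T) (phi : state C U) : state_norm psi = 1%R ->
  normalize (tensor_state psi phi) = tensor_state psi (normalize phi).
Proof.
by move=> N1; apply/ffunP=> x; rewrite !ffunE state_norm_tensor N1 mul1r mulrA.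
Qed.

Lemma enumerates_commute (C : numClosedFieldType) (n k : nat)
    (S : {group pauli n}) (s : 'I_(n - k) -> pauli n) (Zbar : 'I_k -> pauli n)
    (g : 'I_n -> pauli n) :
    stabilizer_code S s -> logical_Z C S s Zbar -> enumerates g s Zbar ->
  forall i j, commute (g i) (g j).
Proof.
move=> [_ abS _ defS _] [_ ZZ ZS _ _] [_ gE].
have sS i : s i \in (S : {set pauli n}) by rewrite defS mem_gen // imset_f.
have gP i : (exists j, g i = s j) \/ (exists j, g i = Zbar j).
  have: g i \in [set g i | i : 'I_n] by rewrite imset_f.
  by rewrite gE inE => /orP[]/imsetP[j _ ->]; [left|right]; exists j.
move=> i j; have [[i' ->]|[i' ->]] := gP i; have [[j' ->]|[j' ->]] := gP j.
- exact: (centsP abS).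
- by apply: commute_sym; apply: ZS.
- exact: ZS.
- exact: ZZ.
Qed.

Theorem mainTheorem1 (C : numClosedFieldType) (n k : nat)
  (S : {group pauli n}) (s : 'I_(n - k) -> pauli n) (Zbar : 'I_k -> pauli n)
  (hS : stabilizer_code S s) (hZ : logical_Z C S s Zbar)
  (g : 'I_n -> pauli n) (hg : enumerates g s Zbar)
  (P : 'I_n -> 'I_n -> letter) (hP : forall i, g i = tensor_pauli (P i))
  (Pcorr : bits n -> pauli n) (hcorr : correction_for g Pcorr)
  (m : bits n) (hm : outcome_prob C P m <> 0%R) :
  exists2 phi : state C (bits n),
    data_state m (final_state C P Pcorr m) phi & logical_zero s Zbar phi.
Proof.
have cg := enumerates_commute hS hZ hg.
set w := data_part m (entangled_state C P).
have N1 := state_norm_product_ketX C m.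
(* The master factor has norm 1, so the outcome probability is the squared norm of [w]. *)
have w0 : state_norm w <> 0%R.
  move=> w0; apply: hm.
  by rewrite /outcome_prob measureX_tensor state_norm_tensor w0 mulr0 expr0n.
have stab i : apply (pauli_op C (g i)) (apply (pauli_op C (Pcorr m)) (normalize w))
    = apply (pauli_op C (Pcorr m)) (normalize w).
  apply: correction_cancels_sign (hcorr m i) _.
  (* As a scalar multiple of [w], the normalized state inherits its eigenvalue by linearity. *)
  have -> : normalize w = [ffun x => (state_norm w)^-1 * w x]%R.
    by apply/ffunP=> x; rewrite !ffunE mulrC.
  rewrite apply_scale hP data_part_entangled_eigen; last first.
    by move=> j; rewrite -!hP.
  by apply/ffunP=> x; rewrite !ffunE mulrCA.
have [_ gE] := hg.
exists (apply (pauli_op C (Pcorr m)) (normalize w)).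
  by rewrite /data_state /final_state measureX_tensor normalize_tensor //
    apply_kron_tensor.
split; first by rewrite state_norm_pauli state_norm_normalize.
(* The enumeration makes every [s i], and below every [Zbar i], one of the [g j] covered by
   [stab]. *)
- move=> i; have: s i \in [set g i | i : 'I_n].
    by rewrite gE inE imset_f.
  by case/imsetP=> j _ ->.
- move=> i; have: Zbar i \in [set g i | i : 'I_n].
    by rewrite gE inE orbC imset_f.
  by case/imsetP=> j _ ->.
Qed.
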